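(* Let $g$ be a symmetric polynomial in $x_1,\dots,x_n$. Then $$\frac1\Delta\nabla_1(\Delta g)=\nabla_1g,\qquad \frac1\Delta\nabla_2(\Delta g)=(\nabla_2+2P_2)g,$$ $$\frac1\Delta\widetilde{D}_1(\Delta g)=(2P_1+\widetilde{D}_1)g,\qquad \frac1\Delta\widetilde{D}_2(\Delta g)=(6Q_2+3\widetilde{P}_2+\widetilde{D}_2)g.$$ Moreover, for every $k\ge 1$, $P_1e_k=\binom{n-k+1}{2}e_{k-1}$.
   Context: Let $n\ge 2$, $\partial_i=\partial/\partial x_i$, and let $\Delta=\prod_{1\le i<j\le n}(x_i-x_j)$ be the Vandermonde determinant. Here $e_k=e_k(x_1,\dots,x_n)$ is the elementary symmetric polynomial of degree $k$ ($e_0=1$, $e_k=0$ for $k<0$ or $k>n$), and $\binom ab=0$ when $a<b$. For $k\ge1$, $\nabla_k=\sum_{i=1}^n\partial_i^k$ and $\widetilde{D}_k=\sum_{i=1}^n x_i\partial_i^{k+1}$. Further $$P_1=\sum_{1\le i<j\le n}\frac{1}{x_i-x_j}(x_i\partial_i-x_j\partial_j),\qquad P_2=\sum_{1\le i<j\le n}\frac{1}{x_i-x_j}(\partial_i-\partial_j),$$ $$\widetilde{P}_2=\sum_{1\le i<j\le n}\frac{1}{x_i-x_j}(x_i\partial_i^2-x_j\partial_j^2),\qquad Q_2=\sum_{j=1}^n\ \sum_{\substack{1\le i<r\le n\\ i,r\neq j}}\frac{1}{(x_j-x_i)(x_j-x_r)}\,x_j\partial_j.$$ *)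

(* Defs.v *)
From HB Require Import structures.
From mathcomp Require Import all_boot all_order all_algebra.
From mathcomp Require Import mpoly.

Set Implicit Arguments.
Unset Strict Implicit.
Unset Printing Implicit Defensive.

Import GRing.Theory.
Local Open Scope ring_scope.

(* Variables are indexed from 0, so x_1, ..., x_n are 'X_0, ..., 'X_(n-1). *)

(* The operators with a denominator take values in the field of rational
   functions, the fraction field of the polynomial ring. *)
Notation mrat n R := {fraction {mpoly R[n]}}.

Section Operators.

Variables (n : nat) (R : idomainType).
Implicit Types (g : {mpoly R[n]}) (i j r : 'I_n) (k : nat).

Definition ratx i : mrat n R := tofrac ('X_i : {mpoly R[n]}).

(* Sign convention: x_i - x_j for i < j, which differs from the determinant of
   mathcomp's Vandermonde matrix by the sign (-1) ^ 'C(n, 2). *)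
Definition vdm : {mpoly R[n]} :=
  \prod_(i < n) \prod_(j < n | (i < j)%N) ('X_i - 'X_j).

Definition nabla k g : {mpoly R[n]} := \sum_(i < n) g^`M(i, k).

Definition Dtilde k g : {mpoly R[n]} := \sum_(i < n) 'X_i * g^`M(i, k.+1).

Definition P1 g : mrat n R :=
  \sum_(i < n) \sum_(j < n | (i < j)%N)
     1 / (ratx i - ratx j) * tofrac ('X_i * g^`M(i) - 'X_j * g^`M(j)).

Definition P2 g : mrat n R :=
  \sum_(i < n) \sum_(j < n | (i < j)%N)
     1 / (ratx i - ratx j) * tofrac (g^`M(i) - g^`M(j)).

Definition P2tilde g : mrat n R :=
  \sum_(i < n) \sum_(j < n | (i < j)%N)
     1 / (ratx i - ratx j) * tofrac ('X_i * g^`M(i, 2) - 'X_j * g^`M(j, 2)).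

Definition Q2 g : mrat n R :=
  \sum_(j < n) \sum_(i < n | i != j) \sum_(r < n | (i < r)%N && (r != j))
     1 / ((ratx j - ratx i) * (ratx j - ratx r)) * tofrac ('X_j * g^`M(j)).

End Operators.

Arguments vdm {n R}.

(* Main.v *)
Require Import Defs.
From HB Require Import structures.
From mathcomp Require Import all_boot all_order all_algebra.
From mathcomp Require Import fingroup perm mpoly.
From mathcomp Require Import ring.

Import GRing.Theory.
Local Open Scope ring_scope.

(** The four conjugation formulas come from the Leibniz rule. Expanding
    [x_i^a ∂_i^b (Δ g)] and summing over [i] leaves three kinds of terms: those
    in which no derivative falls on [Δ], which give back the operator applied to
    [g]; the term [(sum_i x_i^a ∂_i^b Δ) g]; and mixed terms.

    The second kind vanishes whenever [a < b] ([xderiv_vdm]). Up to sign, [Δ] is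
    the determinant of the matrix [(x_j^i)], and applying [sum_j x_j^a ∂_j^b] to
    this determinant amounts to summing, over the rows [i], the determinants in
    which row [i] is replaced by a scalar multiple of the row of exponent
    [i - b + a]. Either the scalar is zero or this row already occurs higher up.

    The mixed terms only involve the logarithmic derivatives of the product [Δ]
    ([vdm_mderiv]): [∂_i Δ / Δ] and [∂_i^2 Δ / Δ] are [e_1] and [2 e_2] of the
    quantities [1 / (x_i - x_j)], [j != i]. The operators [P_1], [P_2], [P~_2],
    [Q_2] are rewritten as sums over [i] with these coefficients by grouping the
    two halves of each summand indexed by a pair [i < j] ([sum_ltn_pairs]).

    For [P_1 e_k], the polynomial [x_i ∂_i e_k] is the sum of the squarefree
    monomials of degree [k] in which [x_i] occurs. In the difference
    [x_i ∂_i e_k - x_j ∂_j e_k] the monomials containing both variables cancel,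
    and what is left is [x_i - x_j] times the sum of the squarefree monomials of
    degree [k - 1] that avoid both ([sum_mon_split]). A given monomial of degree
    [k - 1] avoids ['C(n - k + 1, 2)] pairs ([card_ltn_pairs]). *)

(** * Operators that annihilate the Vandermonde product *)

(** With [a = 0] and [a = 1] this covers both families of operators. *)
Definition xderiv {n} {R : idomainType} a b (g : {mpoly R[n]}) : {mpoly R[n]} :=
  \sum_(j < n) 'X_j ^+ a * g^`M(j, b).

Section Vanish.
Context {n : nat} {R : idomainType}.
Implicit Types (g : {mpoly R[n]}) (i j : 'I_n).

Lemma xderiv_sum (I : finType) (P : pred I) (F : I -> {mpoly R[n]}) a b :
  xderiv a b (\sum_(i | P i) F i) = \sum_(i | P i) xderiv a b (F i).
Proof.
rewrite /xderiv exchange_big /=; apply: eq_bigr => j _.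
by rewrite raddf_sum mulr_sumr.
Qed.

Lemma xderiv_sign a b N g :
  xderiv a b ((-1) ^+ N * g) = (-1) ^+ N * xderiv a b g.
Proof.
rewrite /xderiv mulr_sumr; apply: eq_bigr => j _.
by rewrite -signr_odd raddfMsign mulrCA.
Qed.

(** A generalized Vandermonde matrix: varying the exponent [e i] of a row keeps
    all rows of the same shape. *)
Definition altmx (e : 'I_n -> nat) : 'M[{mpoly R[n]}]_n :=
  \matrix_(i, j) 'X_j ^+ e i.

Lemma vdm_altmx : exists N, vdm = (-1) ^+ N * \det (altmx val) :> {mpoly R[n]}.
Proof.
exists (\sum_(i < n) #|[pred j : 'I_n | (i < j)%N]|)%N.
have -> : altmx val = Vandermonde n (\row_j 'X_j).
  by apply/matrixP=> i j; rewrite !mxE.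
rewrite det_Vandermonde -prodrXr -big_split /=; apply: eq_bigr => i _.
rewrite -prodrN; apply: eq_bigr => j _; by rewrite !mxE opprB.
Qed.

Lemma det_altmx e :
  \det (altmx e) =
    \sum_(s : 'S_n) (-1) ^+ s * 'X_[[multinom e ((s^-1)%g j) | j < n]].
Proof.
apply: eq_bigr => s _; congr (_ * _); rewrite (mpolyXE _ s).
by apply: eq_bigr => i _; rewrite !mxE mnmE permK.
Qed.

Lemma xderiv_monom a b (m : 'X_{1..n}) :
  xderiv a b 'X_[m] = \sum_(j < n) ((m j)^_b)%:R *:
    'X_[[multinom if k == j then (m k - b + a)%N else m k | k < n]]
    :> {mpoly R[n]}.
Proof.
apply: eq_bigr => j _; rewrite mderivnX -scalerAr mpolyXn -mpolyXD.
congr (_ *: 'X_[_]); apply/mnmP=> k; rewrite !mnmE !mulmnE !mnm1E eq_sym.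
by case: (eqVneq k j) => _; rewrite ?mul1n ?mul0n ?add0n ?subn0 // addnC.
Qed.

(** A differential operator acting on one column at a time has the same effect
    on the determinant, after summation over the columns, as when it acts on
    one row at a time; and on row [i] it produces a multiple of row
    [i - b + a], which is zero or a repetition. *)
Lemma xderiv_vdm a b : (a < b)%N -> xderiv a b vdm = 0 :> {mpoly R[n]}.
Proof.
move=> lt_ab; have [N ->] := vdm_altmx; rewrite xderiv_sign.
suff -> : xderiv a b (\det (altmx val)) = 0 :> {mpoly R[n]} by rewrite mulr0.
have -> : xderiv a b (\det (altmx val)) = \sum_(i < n) ((i : nat)^_b)%:R *:
   \det (altmx (fun k => if k == i then (k - b + a)%N else k)) :> {mpoly R[n]}.
  (* In the term of s, column s i meets row i, so the columns are reindexed. *)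
  under [RHS]eq_bigr => i _ do rewrite det_altmx scaler_sumr.
  rewrite det_altmx xderiv_sum [RHS]exchange_big /=; apply: eq_bigr => s _.
  rewrite xderiv_sign xderiv_monom mulr_sumr.
  rewrite (reindex_inj (@perm_inj _ s)) /=; apply: eq_bigr => i _.
  rewrite mnmE permK scalerAr; congr (_ * (_ *: 'X_[_])).
  apply/mnmP=> k; rewrite !mnmE.
  by rewrite -(inj_eq (@perm_inj _ s) _ i) permKV.
(* The subtraction below is truncated when i < b, but then i ^_ b = 0. *)
apply: big1 => i _; case: (ltnP i b) => [lt_ib|le_bi].
  by rewrite ffact_small // scale0r.
have lt_fi : (i - b + a < i)%N by rewrite -{2}(subnK le_bi) ltn_add2l.
pose i' := Ordinal (ltn_trans lt_fi (ltn_ord i)).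
rewrite (@determinant_alternate _ _ _ i i') ?scaler0 //.
  by rewrite -val_eqE /= neq_ltn lt_fi orbT.
move=> j; rewrite !mxE eqxx -val_eqE /=; by rewrite (ltn_eqF lt_fi).
Qed.
End Vanish.

(** * Sums over pairs of indices *)

Lemma sum_ltn_pairs {n} {V : nmodType} (f : 'I_n -> 'I_n -> V) :
  \sum_(i < n) \sum_(j < n | (i < j)%N) (f i j + f j i)
    = \sum_(i < n) \sum_(j < n | j != i) f i j.
Proof.
under eq_bigr => i _ do rewrite big_split.
rewrite big_split /= [X in _ + X](exchange_big_dep predT) //= -big_split /=.
apply: eq_bigr => i _; rewrite [RHS](bigID (fun j : 'I_n => (i < j)%N)) /=.
congr (_ + _); apply: eq_bigl => j; rewrite -val_eqE /=; by case: ltngtP.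
Qed.

Lemma sum_sqr_pairs {n} {V : comPzRingType} (w : 'I_n -> V) (P : pred 'I_n) :
  (\sum_(j < n | P j) w j) ^+ 2 - \sum_(j < n | P j) w j ^+ 2
   = 2%:R * \sum_(a < n | P a) \sum_(b < n | (a < b)%N && P b) w a * w b.
Proof.
pose v j := if P j then w j else 0.
have -> : \sum_(j < n | P j) w j ^+ 2 = \sum_(j < n) v j ^+ 2.
  rewrite big_mkcond; apply: eq_bigr => j _; rewrite /v; case: ifP => //.
  by rewrite expr0n.
have -> : \sum_(a < n | P a) \sum_(b < n | (a < b)%N && P b) w a * w b
          = \sum_(a < n) \sum_(b < n | (a < b)%N) v a * v b.
  rewrite big_mkcond; apply: eq_bigr => a _; rewrite /v; case: ifP => _.
    rewrite big_mkcondr; apply: eq_bigr => b _; case: ifP => //.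
    by rewrite mulr0.
  by rewrite big1 // => b _; rewrite mul0r.
rewrite big_mkcond -/v expr2 big_distrlr /= -sumrB mulr_natl -sumrMnl.
transitivity (\sum_(a < n) \sum_(b < n | b != a) v a * v b).
  by apply: eq_bigr => a _; rewrite (bigD1 a) //= expr2 addrAC subrr add0r.
rewrite -(sum_ltn_pairs (fun a b => v a * v b)).
apply: eq_bigr => a _; rewrite -sumrMnl.
by apply: eq_bigr => b _; rewrite mulr2n (mulrC (v b)).
Qed.

(** Counting the ordered pairs of distinct elements gives twice this sum. *)
Lemma card_ltn_pairs {n} (A : {set 'I_n}) :
  (\sum_(i < n) \sum_(j < n | i < j) ((i \in A) && (j \in A)) = 'C(#|A|, 2))%N.
Proof.
pose f (i j : 'I_n) : nat := (i \in A) && (j \in A).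
have f2 : (\sum_(i < n) \sum_(j < n | i < j) f i j).*2 = (#|A| * #|A|.-1)%N.
  transitivity (\sum_(i < n) \sum_(j < n | j != i) f i j)%N.
    rewrite -[RHS](sum_ltn_pairs f) -muln2 big_distrl; apply: eq_bigr => i _.
    rewrite big_distrl; apply: eq_bigr => j _.
    by rewrite /f [(j \in A) && _]andbC /= muln2 -addnn.
  rewrite -sum_nat_const [RHS]big_mkcond; apply: eq_bigr => i _.
  rewrite /f; case: (boolP (i \in A)) => [iA|_]; last by rewrite big1.
  rewrite (cardsD1 i A) iA -sum1_card big_mkcond [RHS]big_mkcond.
  by apply: eq_bigr => j _; rewrite !inE; case: (j != i); case: (j \in A).
by rewrite bin2 -f2 doubleK.
Qed.

(** * Logarithmic derivatives of the Vandermonde product *)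

Section Log.
Context {n : nat} {R : idomainType}.
Implicit Types (g : {mpoly R[n]}) (i j : 'I_n).
Local Notation F := (mrat n R).
Local Notation tof := (@FracField.tofrac {mpoly R[n]}).

(** Logarithmic differentiation. When the second derivatives of the factors
    vanish, [p'' / p = (p' / p)^2 + (p' / p)'] and the derivative of each
    [u = f' / f] is [- u^2]. *)
Lemma mderiv_prod_log (I : finType) (P : pred I) (f : I -> {mpoly R[n]}) i :
    (forall k, P k -> f k != 0) -> (forall k, P k -> (f k)^`M(i)^`M(i) = 0) ->
  let p := \prod_(k | P k) f k in
  let u k := tof (f k)^`M(i) / tof (f k) in
  tof p^`M(i) = tof p * \sum_(k | P k) u k /\
  tof p^`M(i)^`M(i) =
    tof p * ((\sum_(k | P k) u k) ^+ 2 - \sum_(k | P k) u k ^+ 2).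
Proof.
move=> nz0 d20 p u.
rewrite /p; elim/big_rec3: _ => [|k q s1 s2 Pk [IH1 IH2]].
  by rewrite -mpolyC1 mderivC mderiv0 expr0n subr0 rmorph0 !mulr0.
have nz : tof (f k) != 0 by rewrite tofrac_eq0 nz0.
have e : tof (f k)^`M(i) = tof (f k) * u k by rewrite mulrC divfK.
split; first by rewrite mderivM rmorphD !rmorphM /= IH1 e; ring.
rewrite !(mderivM, mderivD) d20 // mul0r add0r !(rmorphD, rmorphM) /=.
rewrite IH1 IH2 e; ring.
Qed.

Lemma mderiv_var i j : ('X_j : {mpoly R[n]})^`M(i) = (j == i)%:R.
Proof.
rewrite mderivX mnm1E; case: eqVneq => [->|_]; last by rewrite scale0r.
rewrite scale1r -mpolyX0; congr 'X_[_]; apply/mnmP=> k.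
by rewrite mnmBE mnm0E subnn.
Qed.

(** Differentiating with respect to [x_i] sends this difference to 1. *)
Lemma var_sub_neq0 i j : i != j -> ('X_i - 'X_j : {mpoly R[n]}) != 0.
Proof.
move=> ne_ij; apply/eqP => /(congr1 (mderiv i)) /eqP.
rewrite mderivB !mderiv_var mderiv0 eqxx [j == i]eq_sym (negPf ne_ij).
by rewrite subr0 oner_eq0.
Qed.

Lemma vdm_neq0 : tof (@vdm n R) != 0.
Proof.
rewrite tofrac_eq0; apply/prodf_neq0 => i _; apply/prodf_neq0 => j lt_ij.
by rewrite var_sub_neq0 // -val_eqE neq_ltn lt_ij.
Qed.

(** [recip_e1 i] and [recip_e2 i] are the first two elementary symmetric
    functions of the [1 / (x_i - x_j)], [j != i]. *)
Definition recip_e1 i : F := \sum_(j < n | j != i) 1 / (ratx R i - ratx R j).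
Definition recip_e2 i : F := \sum_(j < n | j != i)
  \sum_(r < n | (j < r)%N && (r != i))
    1 / ((ratx R i - ratx R j) * (ratx R i - ratx R r)).

(** Only the pairs containing [i] contribute, and the quotient
    [∂_i (x_a - x_b) / (x_a - x_b)] is symmetric in [a] and [b], so that the
    position of [i] in the pair does not matter. *)
Lemma sum_pair_pow i m : (0 < m)%N ->
  \sum_(p : 'I_n * 'I_n | (p.1 < p.2)%N)
     (tof ('X_p.1 - 'X_p.2)^`M(i) / tof ('X_p.1 - 'X_p.2)) ^+ m
  = \sum_(j < n | j != i) (1 / (ratx R i - ratx R j)) ^+ m.
Proof.
move=> m_gt0.
(* The contribution of the pair {a, b}, charged to its member i. *)
pose f a b : F := if a == i then (1 / (ratx R a - ratx R b)) ^+ m else 0.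
rewrite -(pair_big_dep predT (fun i j : 'I_n => (i < j)%N)
  (fun a b => (tof ('X_a - 'X_b)^`M(i) / tof ('X_a - 'X_b)) ^+ m)) /=.
transitivity (\sum_(a < n) \sum_(b < n | (a < b)%N) (f a b + f b a)).
  apply: eq_bigr => a _; apply: eq_bigr => b lt_ab.
  have ne_ab : a != b by rewrite -val_eqE neq_ltn lt_ab.
  rewrite mderivB !mderiv_var /f rmorphB; have [ea|nea] := eqVneq a i.
    rewrite [b == i]eq_sym -ea (negPf ne_ab) mulr0n mulr1n subr0 addr0 rmorph1.
    by rewrite rmorphB.
  (* Here b = i, or the pair avoids i and both sides vanish. *)
  case: (b == i); rewrite ?add0r; last first.
    by rewrite mulr0n rmorph0 oppr0 mul0r expr0n -(prednK m_gt0).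
  rewrite mulr1n rmorph1 (rmorphB _ 'X_a) -[ratx R b - _]opprB invrN.
  by rewrite mulrN mulNr.
rewrite sum_ltn_pairs (bigD1 i) //= [X in _ + X]big1 ?addr0 => [|a nea].
  by apply: eq_bigr => b _; rewrite /f eqxx.
by apply: big1 => b _; rewrite /f (negPf nea).
Qed.

Lemma vdm_mderiv i :
  tof vdm^`M(i) = tof vdm * recip_e1 i /\
  tof vdm^`M(i)^`M(i) = tof vdm * (2%:R * recip_e2 i).
Proof.
pose f (p : 'I_n * 'I_n) : {mpoly R[n]} := 'X_p.1 - 'X_p.2.
have vdmE : vdm = \prod_(p : 'I_n * 'I_n | (p.1 < p.2)%N) f p.
  by rewrite -(pair_big_dep predT (fun i j : 'I_n => (i < j)%N)
       (fun a b => 'X_a - 'X_b)).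
have [|p _|] := mderiv_prod_log _ (fun p : 'I_n * 'I_n => (p.1 < p.2)%N) f i.
- by move=> p lt_p; rewrite var_sub_neq0 // -val_eqE neq_ltn lt_p.
- by rewrite mderivB !mderiv_var mderivB -!mpolyC_nat !mderivC subrr.
rewrite -vdmE => -> ->; rewrite (sum_pair_pow _ 2) //.
have -> : \sum_(p : 'I_n * 'I_n | (p.1 < p.2)%N) tof (f p)^`M(i) / tof (f p)
          = recip_e1 i by exact: (sum_pair_pow i 1).
split=> //; rewrite /recip_e1 sum_sqr_pairs; congr (_ * (_ * _)).
apply: eq_bigr => a _; apply: eq_bigr => b _.
by rewrite !div1r invfM.
Qed.

Lemma sum_pair_recip_e1 (c : 'I_n -> {mpoly R[n]}) :
  \sum_(i < n) \sum_(j < n | (i < j)%N)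
     1 / (ratx R i - ratx R j) * tof (c i - c j)
  = \sum_(i < n) recip_e1 i * tof (c i).
Proof.
under [RHS]eq_bigr => i _ do rewrite /recip_e1 mulr_suml.
rewrite -sum_ltn_pairs; apply: eq_bigr => i _; apply: eq_bigr => j _.
rewrite rmorphB /= -(opprB (ratx R i)) !div1r invrN; ring.
Qed.

Lemma P1E g : P1 g = \sum_(i < n) recip_e1 i * tof ('X_i * g^`M(i)).
Proof. exact: (sum_pair_recip_e1 (fun i => 'X_i * g^`M(i))). Qed.
Lemma P2E g : P2 g = \sum_(i < n) recip_e1 i * tof g^`M(i).
Proof. exact: (sum_pair_recip_e1 (fun i => g^`M(i))). Qed.
Lemma P2tildeE g :
  P2tilde g = \sum_(i < n) recip_e1 i * tof ('X_i * g^`M(i, 2)).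
Proof. exact: (sum_pair_recip_e1 (fun i => 'X_i * g^`M(i, 2))). Qed.
Lemma Q2E g : Q2 g = \sum_(i < n) recip_e2 i * tof ('X_i * g^`M(i)).
Proof.
apply: eq_bigr => i _; rewrite /recip_e2 mulr_suml; apply: eq_bigr => j _.
by rewrite mulr_suml.
Qed.

(** * Conjugation by the Vandermonde product *)

Lemma conj_xderiv1 g :
  1 / tof vdm * tof (xderiv 0 1 (vdm * g)) = tof (xderiv 0 1 g).
Proof.
have -> : xderiv 0 1 (vdm * g) = xderiv 0 1 vdm * g + vdm * xderiv 0 1 g.
  rewrite /xderiv mulr_suml mulr_sumr -big_split /=; apply: eq_bigr => i _.
  by rewrite !mderivnS !mderivn0 mderivM; ring.
by rewrite xderiv_vdm // mul0r add0r rmorphM /= div1r mulKf ?vdm_neq0.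
Qed.

Lemma conj_xderiv2 a g : (a < 2)%N ->
  1 / tof vdm * tof (xderiv a 2 (vdm * g)) =
  2%:R * (\sum_(i < n) recip_e1 i * tof ('X_i ^+ a * g^`M(i)))
  + tof (xderiv a 2 g).
Proof.
move=> lt_a2.
have -> : xderiv a 2 (vdm * g) = xderiv a 2 vdm * g
   + 2%:R * (\sum_(i < n) vdm^`M(i) * ('X_i ^+ a * g^`M(i)))
   + vdm * xderiv a 2 g.
  rewrite /xderiv mulr_suml !mulr_sumr -!big_split /=; apply: eq_bigr => i _.
  by rewrite !mderivnS !mderivn0 !(mderivM, mderivD); ring.
rewrite xderiv_vdm // mul0r add0r rmorphD !rmorphM rmorph_nat rmorph_sum /=.
under eq_bigr => i _ do rewrite rmorphM /= (vdm_mderiv i).1 -mulrA.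
rewrite -mulr_sumr div1r mulrDr mulKf ?vdm_neq0 // mulrCA mulKf ?vdm_neq0 //.
Qed.

(** The coefficient 6 is the binomial coefficient 3 of the Leibniz rule times
    the factor 2 of [vdm_mderiv]; [a < 3] makes the operator annihilate the
    Vandermonde product. *)
Lemma conj_xderiv3 a g : (a < 3)%N ->
  1 / tof vdm * tof (xderiv a 3 (vdm * g)) =
  6%:R * (\sum_(i < n) recip_e2 i * tof ('X_i ^+ a * g^`M(i)))
  + 3%:R * (\sum_(i < n) recip_e1 i * tof ('X_i ^+ a * g^`M(i, 2)))
  + tof (xderiv a 3 g).
Proof.
move=> lt_a3.
have -> : xderiv a 3 (vdm * g) = xderiv a 3 vdm * g
   + 3%:R * (\sum_(i < n) vdm^`M(i)^`M(i) * ('X_i ^+ a * g^`M(i)))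
   + 3%:R * (\sum_(i < n) vdm^`M(i) * ('X_i ^+ a * g^`M(i, 2)))
   + vdm * xderiv a 3 g.
  rewrite /xderiv mulr_suml !mulr_sumr -!big_split /=; apply: eq_bigr => i _.
  by rewrite !mderivnS !mderivn0 !(mderivM, mderivD); ring.
move: (xderiv a 3 g) => L.
rewrite xderiv_vdm // mul0r add0r !rmorphD !rmorphM !rmorph_nat !rmorph_sum /=.
have -> : \sum_(i < n) tof (vdm^`M(i)^`M(i) * ('X_i ^+ a * g^`M(i)))
    = tof vdm * (2%:R * \sum_(i < n) recip_e2 i * tof ('X_i ^+ a * g^`M(i))).
  rewrite !mulr_sumr; apply: eq_bigr => i _.
  by rewrite rmorphM /= (vdm_mderiv i).2 !mulrA.
have -> : \sum_(i < n) tof (vdm^`M(i) * ('X_i ^+ a * g^`M(i, 2)))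
    = tof vdm * \sum_(i < n) recip_e1 i * tof ('X_i ^+ a * g^`M(i, 2)).
  rewrite mulr_sumr; apply: eq_bigr => i _.
  by rewrite rmorphM /= (vdm_mderiv i).1 mulrA.
set D := tof vdm; have nzD : D != 0 := vdm_neq0.
rewrite div1r; set S := \sum_(i < n) _; set T := \sum_(i < n) _.
(* D^-1 is an atom for ring, so the cancellation is kept as a factor. *)
have e : D^-1 * D = 1 by rewrite mulVf.
transitivity (D^-1 * D * (6%:R * S + 3%:R * T + tof L)).
  by ring.
by rewrite e mul1r.
Qed.

Lemma nablaE k g : nabla k g = xderiv 0 k g.
Proof. by apply: eq_bigr => i _; rewrite expr0 mul1r. Qed.
Lemma DtildeE k g : Dtilde k g = xderiv 1 k.+1 g.
Proof. by []. Qed.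
End Log.

(** * Elementary symmetric polynomials *)

Section ESym.
Context {n : nat} {R : idomainType}.
Implicit Types (i j : 'I_n) (h : {set 'I_n}).
Local Notation mon h := (\prod_(i in h) 'X_i : {mpoly R[n]}).

(** The Euler operator [x_i ∂_i] multiplies a monomial by its degree in
    [x_i]. *)
Lemma euler_mon h i : 'X_i * (mon h)^`M(i) = if i \in h then mon h else 0.
Proof.
have -> : mon h = 'X_[mesym1 h].
  rewrite mpolyXE_id big_mkcond; apply: eq_bigr => k _.
  by rewrite mnmE; case: (k \in h).
rewrite mderivX mnmE; case: (boolP (i \in h)) => [ih|_]; last first.
  by rewrite scale0r mulr0.
rewrite scale1r -mpolyXD; congr 'X_[_].
by apply/mnmP=> k; rewrite !mnmE; case: eqP => [<-|_]; rewrite ?ih // subn0.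
Qed.

Lemma euler_mesym k i :
  'X_i * (mesym n R k)^`M(i) =
    \sum_(h : {set 'I_n} | (#|h| == k) && (i \in h)) mon h.
Proof.
rewrite raddf_sum mulr_sumr big_mkcondr; apply: eq_bigr => h _.
exact: euler_mon.
Qed.

(** The first sum is symmetric in [i] and [j], hence drops out of the
    numerators of [P1]; in the second one [x_i] has been factored out. *)
Lemma sum_mon_split k i j : i != j ->
  \sum_(h : {set 'I_n} | (#|h| == k.+1) && (i \in h)) mon h =
  \sum_(h : {set 'I_n} | [&& #|h| == k.+1, i \in h & j \in h]) mon h
  + 'X_i * \sum_(h : {set 'I_n} | [&& #|h| == k, i \notin h & j \notin h])
             mon h.
Proof.
move=> ne_ij; rewrite (bigID (fun h : {set 'I_n} => j \in h)) /=; congr (_ + _).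
  by apply: eq_bigl => h; rewrite andbA.
rewrite (reindex_onto (fun h : {set 'I_n} => i |: h) (fun h => h :\ i)) /=;
  last first.
  by move=> h /andP[/andP[_ ih] _]; rewrite setD1K.
rewrite mulr_sumr; apply: eq_big => h.
  have [ih|nih] := boolP (i \in h); rewrite /= ?andbF.
    apply/negbTE/negP => /andP[_ /eqP/setP/(_ i)].
    by rewrite !inE eqxx ih.
  rewrite setU1K // eqxx cardsU1 nih !inE eqxx eqSS (eq_sym j) (negPf ne_ij).
  by rewrite /= !andbT.
case/andP=> _ /eqP/setP/(_ i); rewrite !inE eqxx /= => /esym/negbT nih.
by rewrite big_setU1.
Qed.

Lemma P1_mesym_sum k :
  P1 (mesym n R k.+1) = \sum_(i < n) \sum_(j < n | (i < j)%N)
   tofrac (\sum_(h : {set 'I_n} | [&& #|h| == k, i \notin h & j \notin h])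
             mon h).
Proof.
apply: eq_bigr => i _; apply: eq_bigr => j lt_ij.
have ne_ij : i != j by rewrite -val_eqE neq_ltn lt_ij.
rewrite !euler_mesym (sum_mon_split _ i j) // (sum_mon_split _ j i) 1?eq_sym //.
under [X in _ - (X + _)]eq_bigl => h do rewrite [(j \in h) && _]andbC.
under [X in _ - (_ + _ * X)]eq_bigl => h do rewrite [(j \notin h) && _]andbC.
rewrite opprD addrACA subrr add0r -mulrBl rmorphM rmorphB /= div1r mulKf //.
by rewrite -rmorphB tofrac_eq0 var_sub_neq0.
Qed.

Lemma P1_mesym k :
  P1 (mesym n R k.+1) = tofrac ('C(n - k, 2)%:R * mesym n R k).
Proof.
rewrite P1_mesym_sum mulr_sumr rmorph_sum /=.
under eq_bigr => i _ do rewrite -rmorph_sum.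
rewrite -rmorph_sum -rmorph_sum; congr tofrac.
under eq_bigr => i _ do under eq_bigr => j _ do rewrite big_mkcondr.
under eq_bigr => i _ do rewrite exchange_big.
rewrite exchange_big; apply: eq_bigr => h /eqP card_h /=.
have -> : (n - k = #|~: h|)%N by rewrite cardsCs setCK card_h card_ord.
rewrite -card_ltn_pairs natr_sum mulr_suml; apply: eq_bigr => i _.
rewrite natr_sum mulr_suml; apply: eq_bigr => j _.
by rewrite !inE; case: ifP => _; rewrite ?mul1r ?mul0r.
Qed.
End ESym.

Theorem mainTheorem11 (n : nat) (hn : (2 <= n)%N) (R : idomainType) :
  (forall g : {mpoly R[n]}, g \is symmetric ->
    [/\ 1 / tofrac vdm * tofrac (nabla 1 (vdm * g)) = tofrac (nabla 1 g),
        1 / tofrac vdm * tofrac (nabla 2 (vdm * g))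
          = tofrac (nabla 2 g) + 2%:R * P2 g,
        1 / tofrac vdm * tofrac (Dtilde 1 (vdm * g))
          = 2%:R * P1 g + tofrac (Dtilde 1 g)
      & 1 / tofrac vdm * tofrac (Dtilde 2 (vdm * g))
          = 6%:R * Q2 g + 3%:R * P2tilde g + tofrac (Dtilde 2 g)])
  /\
  (forall k : nat, (1 <= k)%N ->
    P1 (mesym n R k)
      = tofrac ('C(n.+1 - k, 2)%:R * mesym n R k.-1)).
Proof.
split=> [g _|[//|k] _]; last by rewrite P1_mesym.
split; rewrite ?nablaE ?DtildeE.
- exact: conj_xderiv1.
- rewrite conj_xderiv2 // addrC P2E; congr (_ + _ * _).
  by apply: eq_bigr => i _; rewrite expr0 mul1r.
- by rewrite conj_xderiv2 // P1E.
- by rewrite conj_xderiv3 // P2tildeE Q2E.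
Qed.
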